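(* (Progress.) Let $M$ be a closed choreography of Chor$\lambda$ and let $D$ be a collection of named choreographies containing all the definitions necessary for $M$. If there exists a typing context $\Theta;\Sigma;\Gamma$ and a type $T$ such that $\Theta;\Sigma;\Gamma\vdash M:T$ and $\Theta;\Sigma;\Gamma\vdash D$, then either $M$ is a value (and there is no $M'$ with $M\to_D M'$), or there exists a choreography $M'$ such that $M\to_D M'$.
   Context: **Syntax of Chor$\lambda$.** There are variables $x$, labels $l$, choreography (function) names $f$, roles $R,S$, and type variables $t$; $\rho$ ranges over finite sets of roles, $\vec R$ over lists of roles. Choreographies $M$, values $V$, types $T$: - $M ::= V \mid f(\vec R)\mid M\,M\mid \mathsf{case}\ M\ \mathsf{of}\ \mathsf{Inl}\,x\Rightarrow M;\ \mathsf{Inr}\,x\Rightarrow M\mid \mathsf{select}_{R,R}\,l\,M$ - $V ::= x\mid \lambda x{:}T.M\mid \mathsf{Inl}\,V\mid\mathsf{Inr}\,V\mid\mathsf{fst}\mid\mathsf{snd}\mid\mathsf{Pair}\,V\,V\mid ()@R\mid \mathsf{com}_{R,R}$ - $T ::= T\to_\rho T\mid T+T\mid T\times T\mid ()@R\mid t@\vec R$ $\lambda x{:}T.M$ binds $x$ in $M$; $\mathsf{case}\ N\ \mathsf{of}\ \mathsf{Inl}\,x\Rightarrow M;\ \mathsf{Inr}\,x'\Rightarrow M'$ binds $x$ in $M$ and $x'$ in $M'$; terms are taken up to renaming of bound variables. $\mathrm{fv}(M)$ is the set of free variables; $M$ is closed if $\mathrm{fv}(M)=\emptyset$. $[x:=V]$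 is capture-avoiding substitution; $[S:=R]$ and $[\vec R':=\vec R]$ are (simultaneous) replacement of roles. $\mathrm{roles}(t@\vec R)=\vec R$, $\mathrm{roles}(()@R)=\{R\}$, $\mathrm{roles}(T\to_\rho T')=\mathrm{roles}(T)\cup\mathrm{roles}(T')\cup\rho$, $\mathrm{roles}(T+T')=\mathrm{roles}(T\times T')=\mathrm{roles}(T)\cup\mathrm{roles}(T')$. $\mathrm{roles}(M)$ is the set of roles occurring in $M$. Synchronising roles: $\mathrm{sroles}(\mathsf{com}_{S,R})=\{S,R\}$, $\mathrm{sroles}(\mathsf{select}_{S,R}\,l\,M)=\{S,R\}\cup\mathrm{sroles}(M)$, $\mathrm{sroles}(f(\vec R))=\vec R$, and in all other cases the union over the immediate subterms. A set of definitions $D$ maps expressions $f(\vec R)$ ($\vec R$ the role parameters) to choreographies $D(f(\vec R))$. **Typing.** In $\Theta;\Sigma;\Gamma\vdash M:T$: $\Theta$ is a set of roles; $\Sigma$ is a set of type definitions $t@\vec R=T$ with $\vec R$ distinct, each $t$ defined at most once, definitions contractive, and $\mathrm{roles}(T)=\vec R$; $\Gamma$ contains assignments $x:T$ and $f(\vec R):T$, each name occurring at most once. $\mathrm{dist}(\vec R)$ means the elements of $\vec R$ are distinct, $\|\vec R\|$ is the length. Rules: - TVar: $\Theta;\Sigma;\Gamma\vdash x:T$ if $x:T\in\Gamma$ and $\mathrm{roles}(T)\subseteq\Theta$. - TApp: $\Theta;\Sigma;\Gamma\vdash N\,M:T'$ if $\Theta;\Sigma;\Gamma\vdash N:T\to_\rho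 T'$ and $\Theta;\Sigma;\Gamma\vdash M:T$. - TAbs: $\Theta;\Sigma;\Gamma\vdash\lambda x{:}T.M:T\to_\rho T'$ if $\Theta';\Sigma;\Gamma,x:T\vdash M:T'$ with $\Theta'=\rho\cup\mathrm{roles}(T)\cup\mathrm{roles}(T')\subseteq\Theta$. - TCase: $\Theta;\Sigma;\Gamma\vdash\mathsf{case}\ N\ \mathsf{of}\ \mathsf{Inl}\,x\Rightarrow M';\ \mathsf{Inr}\,x'\Rightarrow M'':T$ if $\Theta;\Sigma;\Gamma\vdash N:T_1+T_2$, $\Theta;\Sigma;\Gamma,x:T_1\vdash M':T$, $\Theta;\Sigma;\Gamma,x':T_2\vdash M'':T$. - TSel: $\Theta;\Sigma;\Gamma\vdash\mathsf{select}_{S,R}\,l\,M:T$ if $\Theta;\Sigma;\Gamma\vdash M:T$ and $\{S,R\}\subseteq\Theta$. - TDef: $\Theta;\Sigma;\Gamma\vdash f(\vec R):T[\vec R':=\vec R]$ if $f(\vec R'):T\in\Gamma$, $\mathrm{roles}(T)\subseteq\vec R'$, $\vec R\subseteq\Theta$, $\|\vec R\|=\|\vec R'\|$, $\mathrm{dist}(\vec R)$. - TUnit: $\Theta;\Sigma;\Gamma\vdash ()@R:()@R$ if $R\in\Theta$. - TCom: $\Theta;\Sigma;\Gamma\vdash\mathsf{com}_{S,R}:T\to_\emptyset T[S:=R]$ if $\mathrm{roles}(T)=\{S\}$ and $\{S,R\}\subseteq\Theta$. - TPair: $\Theta;\Sigma;\Gamma\vdash\mathsf{Pair}\,V\,V':T\times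 T'$ if $\Theta;\Sigma;\Gamma\vdash V:T$ and $\Theta;\Sigma;\Gamma\vdash V':T'$. - TProj1/2: $\Theta;\Sigma;\Gamma\vdash\mathsf{fst}:(T\times T')\to_\emptyset T$ and $\Theta;\Sigma;\Gamma\vdash\mathsf{snd}:(T\times T')\to_\emptyset T'$ if $\mathrm{roles}(T\times T')\subseteq\Theta$. - TInl/TInr: $\Theta;\Sigma;\Gamma\vdash\mathsf{Inl}\,V:T+T'$ if $\Theta;\Sigma;\Gamma\vdash V:T$ (resp. $\mathsf{Inr}\,V:T+T'$ if $V:T'$) and $\mathrm{roles}(T+T')\subseteq\Theta$. - TEq: $\Theta;\Sigma;\Gamma\vdash M:T[\vec R:=\vec R']$ if $\Theta;\Sigma;\Gamma\vdash M:t@\vec R'$, $t@\vec R=T$ is in $\Sigma$, $\vec R'\subseteq\Theta$, $\|\vec R\|=\|\vec R'\|$, $\mathrm{dist}(\vec R')$. $\Theta;\Sigma;\Gamma\vdash D$ holds if for every $f(\vec R)\in\mathrm{domain}(D)$ there is $T$ with $f(\vec R):T\in\Gamma$, $\vec R;\Sigma;\Gamma\vdash D(f(\vec R)):T$, $\mathrm{dist}(\vec R)$, and $\vec R\subseteq\Theta$. **Rewriting** $\rightsquigarrow$ is given by: - R-AbsR: $((\lambda x{:}T.M)\,N)\,M'\rightsquigarrow(\lambda x{:}T.(M\,M'))\,N$ if $x\notin\mathrm{fv}(M')$. - R-AbsL: $M'\,((\lambda x{:}T.M)\,N)\rightsquigarrow(\lambda x{:}T.(M'\,M))\,N$ if $x\notin\mathrm{fv}(M')$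 and $\mathrm{sroles}(M')\cap\mathrm{roles}(N)=\emptyset$. - R-CaseR: $(\mathsf{case}\ N\ \mathsf{of}\ \mathsf{Inl}\,x\Rightarrow M_1;\mathsf{Inr}\,x'\Rightarrow M_2)\,M\rightsquigarrow\mathsf{case}\ N\ \mathsf{of}\ \mathsf{Inl}\,x\Rightarrow (M_1\,M);\mathsf{Inr}\,x'\Rightarrow (M_2\,M)$ if $x,x'\notin\mathrm{fv}(M)$. - R-CaseL: $M\,(\mathsf{case}\ N\ \mathsf{of}\ \mathsf{Inl}\,x\Rightarrow M_1;\mathsf{Inr}\,x'\Rightarrow M_2)\rightsquigarrow\mathsf{case}\ N\ \mathsf{of}\ \mathsf{Inl}\,x\Rightarrow (M\,M_1);\mathsf{Inr}\,x'\Rightarrow (M\,M_2)$ if $x,x'\notin\mathrm{fv}(M)$ and $\mathrm{sroles}(M)\cap\mathrm{roles}(N)=\emptyset$. - R-SelR: $(\mathsf{select}_{S,R}\,l\,N)\,M\rightsquigarrow\mathsf{select}_{S,R}\,l\,(N\,M)$. - R-SelL: $M\,(\mathsf{select}_{S,R}\,l\,N)\rightsquigarrow\mathsf{select}_{S,R}\,l\,(M\,N)$ if $\mathrm{sroles}(M)\cap\mathrm{roles}(N)=\emptyset$. **Semantics.** Transitions $M\xrightarrow{\ell,\mathbf R}_D M'$ with $\ell\in\{\tau,\lambda\}$ and $\mathbf R$ a set of roles: - AppAbs: $(\lambda x{:}T.M)\,V\xrightarrow{\tau,\emptyset}_D M[x:=V]$. - InAbs: $\lambda x{:}T.M\xrightarrow{\lambda,\mathbf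 R}_D\lambda x{:}T.M'$ if $M\xrightarrow{\ell,\mathbf R}_D M'$. - App1: $M\,N\xrightarrow{\tau,\mathbf R}_D M'\,N$ if $M\xrightarrow{\ell,\mathbf R}_D M'$ and ($\ell=\lambda$ implies $\mathbf R\cap\mathrm{roles}(N)=\emptyset$). - App2: $V\,N\xrightarrow{\tau,\mathbf R}_D V\,N'$ if $N\xrightarrow{\tau,\mathbf R}_D N'$. - App3: $M\,N\xrightarrow{\tau,\mathbf R}_D M\,N'$ if $N\xrightarrow{\tau,\mathbf R}_D N'$ and $\mathbf R\cap\mathrm{roles}(M)=\emptyset$. - Case: $\mathsf{case}\ N\ \mathsf{of}\ \mathsf{Inl}\,x\Rightarrow M;\mathsf{Inr}\,x'\Rightarrow M'\xrightarrow{\tau,\mathbf R}_D\mathsf{case}\ N'\ \mathsf{of}\ \mathsf{Inl}\,x\Rightarrow M;\mathsf{Inr}\,x'\Rightarrow M'$ if $N\xrightarrow{\tau,\mathbf R}_D N'$. - InCase: $\mathsf{case}\ N\ \mathsf{of}\ \mathsf{Inl}\,x\Rightarrow M_1;\mathsf{Inr}\,x'\Rightarrow M_2\xrightarrow{\ell,\mathbf R}_D\mathsf{case}\ N\ \mathsf{of}\ \mathsf{Inl}\,x\Rightarrow M_1';\mathsf{Inr}\,x'\Rightarrow M_2'$ if $M_1\xrightarrow{\ell,\mathbf R}_D M_1'$, $M_2\xrightarrow{\ell,\mathbf R}_D M_2'$, $\mathbf R\cap\mathrm{roles}(N)=\emptyset$. - CaseL/CaseR: $\mathsf{case}\ \mathsf{Inl}\,V\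 \mathsf{of}\ \mathsf{Inl}\,x\Rightarrow M;\mathsf{Inr}\,x'\Rightarrow M'\xrightarrow{\tau,\emptyset}_D M[x:=V]$; the same with $\mathsf{Inr}\,V$ as scrutinee steps to $M'[x':=V]$. - Proj1/Proj2: $\mathsf{fst}\,(\mathsf{Pair}\,V\,V')\xrightarrow{\tau,\emptyset}_D V$; $\mathsf{snd}\,(\mathsf{Pair}\,V\,V')\xrightarrow{\tau,\emptyset}_D V'$. - Def: $f(\vec R)\xrightarrow{\tau,\emptyset}_D M[\vec R':=\vec R]$ if $D(f(\vec R'))=M$. - Com: $\mathsf{com}_{S,R}\,V\xrightarrow{\tau,\{S,R\}}_D V[S:=R]$ if $\mathrm{fv}(V)=\emptyset$. - Sel: $\mathsf{select}_{S,R}\,l\,M\xrightarrow{\tau,\{S,R\}}_D M$. - InSel: $\mathsf{select}_{S,R}\,l\,M\xrightarrow{\ell,\mathbf R}_D\mathsf{select}_{S,R}\,l\,M'$ if $M\xrightarrow{\ell,\mathbf R}_D M'$ and $\mathbf R\cap\{S,R\}=\emptyset$. - Str: $M\xrightarrow{\tau,\mathbf R}_D M'$ if $M\rightsquigarrow^* N$ and $N\xrightarrow{\tau,\mathbf R}_D M'$. $M\to_D M'$ means $M\xrightarrow{\tau,\mathbf R}_D M'$ for some $\mathbf R$. *)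

(* Defs.v *)
From Stdlib Require Import List Relation_Operators.
From mathcomp Require Import all_boot finmap.
Set Implicit Arguments.
Unset Strict Implicit.
Unset Printing Implicit Defensive.

Local Open Scope fset_scope.

(* The four syntactic categories of names are countably infinite sets. *)
Definition role : countType := nat.
Definition label : countType := nat.
Definition fname : countType := nat.
Definition tvar : countType := nat.

Inductive ty : Type :=
| TArr of ty & {fset role} & ty
| TSum of ty & ty
| TProd of ty & ty
| TUnit of role
| TName of tvar & seq role.

(* Choreographies up to renaming of bound variables, in de Bruijn notation:
   index 0 is bound by the nearest enclosing [Lam] or [Case] branch; each of
   the two branches of [Case] binds one variable. *)
Inductive chor : Type :=
| Val of val
| Call of fname & seq role
| App of chor & chor
| Case of chor & chor & chor
| Select of role & role & label & chor
with val : Type :=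
| Var of nat
| Lam of ty & chor
| Inl of val
| Inr of val
| Fst
| Snd
| Pair of val & val
| Unit of role
| Com of role & role.

Coercion Val : val >-> chor.

Definition is_value (M : chor) : Prop := exists V : val, M = V.

Definition fset_of (Rs : seq role) : {fset role} := [fset R in Rs].

Fixpoint roles_ty (T : ty) : {fset role} :=
  match T with
  | TArr T1 rho T2 => roles_ty T1 `|` roles_ty T2 `|` rho
  | TSum T1 T2 | TProd T1 T2 => roles_ty T1 `|` roles_ty T2
  | TUnit R => [fset R]
  | TName _ Rs => fset_of Rs
  end.

Fixpoint roles (M : chor) : {fset role} :=
  match M with
  | Val V => roles_val V
  | Call _ Rs => fset_of Rs
  | App M1 M2 => roles M1 `|` roles M2
  | Case N M1 M2 => roles N `|` roles M1 `|` roles M2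
  | Select Q R _ M1 => [fset Q; R] `|` roles M1
  end
with roles_val (V : val) : {fset role} :=
  match V with
  | Var _ | Fst | Snd => fset0
  | Lam T M => roles_ty T `|` roles M
  | Inl V1 | Inr V1 => roles_val V1
  | Pair V1 V2 => roles_val V1 `|` roles_val V2
  | Unit R => [fset R]
  | Com Q R => [fset Q; R]
  end.

Fixpoint sroles (M : chor) : {fset role} :=
  match M with
  | Val V => sroles_val V
  | Call _ Rs => fset_of Rs
  | App M1 M2 => sroles M1 `|` sroles M2
  | Case N M1 M2 => sroles N `|` sroles M1 `|` sroles M2
  | Select Q R _ M1 => [fset Q; R] `|` sroles M1
  end
with sroles_val (V : val) : {fset role} :=
  match V with
  | Var _ | Fst | Snd | Unit _ => fset0
  | Lam _ M => sroles M
  | Inl V1 | Inr V1 => sroles_val V1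
  | Pair V1 V2 => sroles_val V1 `|` sroles_val V2
  | Com Q R => [fset Q; R]
  end.

(* Free variables of the body of a binder, seen from outside the binder. *)
Definition unbind (A : {fset nat}) : {fset nat} :=
  [fset i.-1 | i in A & 0 < i].

Fixpoint fv (M : chor) : {fset nat} :=
  match M with
  | Val V => fv_val V
  | Call _ _ => fset0
  | App M1 M2 => fv M1 `|` fv M2
  | Case N M1 M2 => fv N `|` unbind (fv M1) `|` unbind (fv M2)
  | Select _ _ _ M1 => fv M1
  end
with fv_val (V : val) : {fset nat} :=
  match V with
  | Var i => [fset i]
  | Lam _ M => unbind (fv M)
  | Inl V1 | Inr V1 => fv_val V1
  | Pair V1 V2 => fv_val V1 `|` fv_val V2
  | Fst | Snd | Unit _ | Com _ _ => fset0
  end.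

Definition closed_chor (M : chor) : Prop := fv M = fset0.

Definition up_ren (r : nat -> nat) (i : nat) : nat :=
  if i is j.+1 then (r j).+1 else 0.

Fixpoint ren (r : nat -> nat) (M : chor) : chor :=
  match M with
  | Val V => ren_val r V
  | Call f Rs => Call f Rs
  | App M1 M2 => App (ren r M1) (ren r M2)
  | Case N M1 M2 => Case (ren r N) (ren (up_ren r) M1) (ren (up_ren r) M2)
  | Select Q R l M1 => Select Q R l (ren r M1)
  end
with ren_val (r : nat -> nat) (V : val) : val :=
  match V with
  | Var i => Var (r i)
  | Lam T M => Lam T (ren (up_ren r) M)
  | Inl V1 => Inl (ren_val r V1)
  | Inr V1 => Inr (ren_val r V1)
  | Pair V1 V2 => Pair (ren_val r V1) (ren_val r V2)
  | Fst => Fst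
  | Snd => Snd
  | Unit R => Unit R
  | Com Q R => Com Q R
  end.

(* Moving a term under a binder.  The new index 0 does not occur in [shift M],
   which is what the side conditions [x \notin fv(M)] of the named presentation
   express. *)
Definition shift (M : chor) : chor := ren succn M.

Definition up_subst (s : nat -> val) (i : nat) : val :=
  if i is j.+1 then ren_val succn (s j) else Var 0.

Fixpoint subst (s : nat -> val) (M : chor) : chor :=
  match M with
  | Val V => subst_val s V
  | Call f Rs => Call f Rs
  | App M1 M2 => App (subst s M1) (subst s M2)
  | Case N M1 M2 =>
      Case (subst s N) (subst (up_subst s) M1) (subst (up_subst s) M2)
  | Select Q R l M1 => Select Q R l (subst s M1)
  end
with subst_val (s : nat -> val) (V : val) : val :=
  match V with
  | Var i => s i
  | Lam T M => Lam T (subst (up_subst s) M)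
  | Inl V1 => Inl (subst_val s V1)
  | Inr V1 => Inr (subst_val s V1)
  | Pair V1 V2 => Pair (subst_val s V1) (subst_val s V2)
  | Fst => Fst
  | Snd => Snd
  | Unit R => Unit R
  | Com Q R => Com Q R
  end.

(* M[x := V], where x is the variable bound just outside M *)
Definition subst0 (V : val) (M : chor) : chor :=
  subst (fun i => if i is j.+1 then Var j else V) M.

(* Simultaneous replacement [Rs' := Rs] of roles.  It is only used on lists of
   equal length; roles outside Rs' are left unchanged, since [index] then
   returns [size Rs']. *)
Definition rsub (Rs' Rs : seq role) (r : role) : role :=
  nth r Rs (index r Rs').

Fixpoint rsub_ty (Rs' Rs : seq role) (T : ty) : ty :=
  match T with
  | TArr T1 rho T2 =>
      TArr (rsub_ty Rs' Rs T1) [fset rsub Rs' Rs r | r in rho]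
           (rsub_ty Rs' Rs T2)
  | TSum T1 T2 => TSum (rsub_ty Rs' Rs T1) (rsub_ty Rs' Rs T2)
  | TProd T1 T2 => TProd (rsub_ty Rs' Rs T1) (rsub_ty Rs' Rs T2)
  | TUnit R => TUnit (rsub Rs' Rs R)
  | TName t Ps => TName t (map (rsub Rs' Rs) Ps)
  end.

Fixpoint rsub_chor (Rs' Rs : seq role) (M : chor) : chor :=
  match M with
  | Val V => rsub_val Rs' Rs V
  | Call f Ps => Call f (map (rsub Rs' Rs) Ps)
  | App M1 M2 => App (rsub_chor Rs' Rs M1) (rsub_chor Rs' Rs M2)
  | Case N M1 M2 =>
      Case (rsub_chor Rs' Rs N) (rsub_chor Rs' Rs M1) (rsub_chor Rs' Rs M2)
  | Select Q R l M1 =>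
      Select (rsub Rs' Rs Q) (rsub Rs' Rs R) l (rsub_chor Rs' Rs M1)
  end
with rsub_val (Rs' Rs : seq role) (V : val) : val :=
  match V with
  | Var i => Var i
  | Lam T M => Lam (rsub_ty Rs' Rs T) (rsub_chor Rs' Rs M)
  | Inl V1 => Inl (rsub_val Rs' Rs V1)
  | Inr V1 => Inr (rsub_val Rs' Rs V1)
  | Pair V1 V2 => Pair (rsub_val Rs' Rs V1) (rsub_val Rs' Rs V2)
  | Fst => Fst
  | Snd => Snd
  | Unit R => Unit (rsub Rs' Rs R)
  | Com Q R => Com (rsub Rs' Rs Q) (rsub Rs' Rs R)
  end.

(* [D f Rs = Some M] means that f(Rs) is in the domain of D and D(f(Rs)) = M. *)
Definition defs : Type := fname -> seq role -> option chor.

(* D seen from under a binder: free variables of the bodies, if any, keep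
   referring to the same variables. *)
Definition shift_defs (D : defs) : defs := fun f Rs => omap shift (D f Rs).

Fixpoint called (M : chor) : {fset fname} :=
  match M with
  | Val V => called_val V
  | Call f _ => [fset f]
  | App M1 M2 => called M1 `|` called M2
  | Case N M1 M2 => called N `|` called M1 `|` called M2
  | Select _ _ _ M1 => called M1
  end
with called_val (V : val) : {fset fname} :=
  match V with
  | Lam _ M => called M
  | Inl V1 | Inr V1 => called_val V1
  | Pair V1 V2 => called_val V1 `|` called_val V2
  | Var _ | Fst | Snd | Unit _ | Com _ _ => fset0
  end.

(* The names M depends on, directly or through the bodies in D of names it
   depends on. *)
Inductive needed (D : defs) (M : chor) : fname -> Prop :=
| Needed_here f : f \in called M -> needed D M f
| Needed_body g Rs N f :
    needed D M g -> D g Rs = Some N -> f \in called N -> needed D M f.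

Definition has_necessary_defs (D : defs) (M : chor) : Prop :=
  forall f, needed D M f -> exists Rs N, D f Rs = Some N.

(* t@Rs = T *)
Record tdef : Type := TDecl { td_name : tvar; td_params : seq role; td_ty : ty }.

(* f(Rs) : T *)
Record fdecl : Type := FDecl { fd_name : fname; fd_params : seq role; fd_ty : ty }.

(* A typing context assigns the i-th type of [vars] to the variable of index i,
   so that every variable occurs at most once by construction. *)
Record tctx : Type := TCtx { vars : seq ty; funs : seq fdecl }.

Definition ext (Gamma : tctx) (T : ty) : tctx :=
  TCtx (T :: vars Gamma) (funs Gamma).

(* The definition of t is, without an intervening type constructor, an instance
   of u. *)
Definition unguarded (Sigma : seq tdef) (t u : tvar) : Prop :=
  exists Rs Us, In (TDecl t Rs (TName u Us)) Sigma.

Definition contractive (Sigma : seq tdef) : Prop :=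
  forall t, ~ clos_trans tvar (unguarded Sigma) t t.

Definition wf_tdefs (Sigma : seq tdef) : Prop :=
  [/\ uniq (map td_name Sigma),
      contractive Sigma &
      forall t Rs T, In (TDecl t Rs T) Sigma ->
        uniq Rs /\ roles_ty T = fset_of Rs].

Definition wf_tctx (Gamma : tctx) : Prop := uniq (map fd_name (funs Gamma)).

Inductive typed : {fset role} -> seq tdef -> tctx -> chor -> ty -> Prop :=
| Ty_Var Theta Sigma Gamma i T :
    onth (vars Gamma) i = Some T -> roles_ty T `<=` Theta ->
    typed Theta Sigma Gamma (Var i) T
| Ty_App Theta Sigma Gamma N M T rho T' :
    typed Theta Sigma Gamma N (TArr T rho T') ->
    typed Theta Sigma Gamma M T ->
    typed Theta Sigma Gamma (App N M) T'
| Ty_Abs Theta Theta' Sigma Gamma T M rho T' :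
    typed Theta' Sigma (ext Gamma T) M T' ->
    Theta' = rho `|` roles_ty T `|` roles_ty T' ->
    Theta' `<=` Theta ->
    typed Theta Sigma Gamma (Lam T M) (TArr T rho T')
| Ty_Case Theta Sigma Gamma N M' M'' T1 T2 T :
    typed Theta Sigma Gamma N (TSum T1 T2) ->
    typed Theta Sigma (ext Gamma T1) M' T ->
    typed Theta Sigma (ext Gamma T2) M'' T ->
    typed Theta Sigma Gamma (Case N M' M'') T
| Ty_Sel Theta Sigma Gamma Q R l M T :
    typed Theta Sigma Gamma M T ->
    [fset Q; R] `<=` Theta ->
    typed Theta Sigma Gamma (Select Q R l M) T
| Ty_Def Theta Sigma Gamma f Rs' Rs T :
    In (FDecl f Rs' T) (funs Gamma) ->
    roles_ty T `<=` fset_of Rs' ->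
    fset_of Rs `<=` Theta ->
    size Rs = size Rs' ->
    uniq Rs ->
    typed Theta Sigma Gamma (Call f Rs) (rsub_ty Rs' Rs T)
| Ty_Unit Theta Sigma Gamma R :
    R \in Theta ->
    typed Theta Sigma Gamma (Unit R) (TUnit R)
| Ty_Com Theta Sigma Gamma Q R T :
    roles_ty T = [fset Q] ->
    [fset Q; R] `<=` Theta ->
    typed Theta Sigma Gamma (Com Q R) (TArr T fset0 (rsub_ty [:: Q] [:: R] T))
| Ty_Pair Theta Sigma Gamma (V V' : val) T T' :
    typed Theta Sigma Gamma V T ->
    typed Theta Sigma Gamma V' T' ->
    typed Theta Sigma Gamma (Pair V V') (TProd T T')
| Ty_Proj1 Theta Sigma Gamma T T' :
    roles_ty (TProd T T') `<=` Theta ->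
    typed Theta Sigma Gamma Fst (TArr (TProd T T') fset0 T)
| Ty_Proj2 Theta Sigma Gamma T T' :
    roles_ty (TProd T T') `<=` Theta ->
    typed Theta Sigma Gamma Snd (TArr (TProd T T') fset0 T')
| Ty_Inl Theta Sigma Gamma (V : val) T T' :
    typed Theta Sigma Gamma V T ->
    roles_ty (TSum T T') `<=` Theta ->
    typed Theta Sigma Gamma (Inl V) (TSum T T')
| Ty_Inr Theta Sigma Gamma (V : val) T T' :
    typed Theta Sigma Gamma V T' ->
    roles_ty (TSum T T') `<=` Theta ->
    typed Theta Sigma Gamma (Inr V) (TSum T T')
| Ty_Eq Theta Sigma Gamma M t Rs Rs' T :
    typed Theta Sigma Gamma M (TName t Rs') ->
    In (TDecl t Rs T) Sigma ->
    fset_of Rs' `<=` Theta ->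
    size Rs = size Rs' ->
    uniq Rs' ->
    typed Theta Sigma Gamma M (rsub_ty Rs Rs' T).

Definition typed_defs (Theta : {fset role}) (Sigma : seq tdef) (Gamma : tctx)
    (D : defs) : Prop :=
  forall f Rs M, D f Rs = Some M ->
    exists T, [/\ In (FDecl f Rs T) (funs Gamma),
                  typed (fset_of Rs) Sigma Gamma M T,
                  uniq Rs &
                  fset_of Rs `<=` Theta].

Inductive rewr : chor -> chor -> Prop :=
| R_AbsR T M N M' :
    rewr (App (App (Lam T M) N) M') (App (Lam T (App M (shift M'))) N)
| R_AbsL T M N M' :
    sroles M' `&` roles N = fset0 ->
    rewr (App M' (App (Lam T M) N)) (App (Lam T (App (shift M') M)) N)
| R_CaseR N M1 M2 M :
    rewr (App (Case N M1 M2) M)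
         (Case N (App M1 (shift M)) (App M2 (shift M)))
| R_CaseL N M1 M2 M :
    sroles M `&` roles N = fset0 ->
    rewr (App M (Case N M1 M2))
         (Case N (App (shift M) M1) (App (shift M) M2))
| R_SelR Q R l N M :
    rewr (App (Select Q R l N) M) (Select Q R l (App N M))
| R_SelL Q R l N M :
    sroles M `&` roles N = fset0 ->
    rewr (App M (Select Q R l N)) (Select Q R l (App M N)).

Inductive act : Type := Tau | Lambda.

Inductive step : defs -> chor -> act -> {fset role} -> chor -> Prop :=
| S_AppAbs D T M (V : val) :
    step D (App (Lam T M) V) Tau fset0 (subst0 V M)
| S_InAbs D T M M' a Rs :
    step (shift_defs D) M a Rs M' ->
    step D (Lam T M) Lambda Rs (Lam T M')
| S_App1 D M N M' a Rs :
    step D M a Rs M' ->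
    (a = Lambda -> Rs `&` roles N = fset0) ->
    step D (App M N) Tau Rs (App M' N)
| S_App2 D (V : val) N N' Rs :
    step D N Tau Rs N' ->
    step D (App V N) Tau Rs (App V N')
| S_App3 D M N N' Rs :
    step D N Tau Rs N' ->
    Rs `&` roles M = fset0 ->
    step D (App M N) Tau Rs (App M N')
| S_Case D N M M' N' Rs :
    step D N Tau Rs N' ->
    step D (Case N M M') Tau Rs (Case N' M M')
| S_InCase D N M1 M2 M1' M2' a Rs :
    step (shift_defs D) M1 a Rs M1' ->
    step (shift_defs D) M2 a Rs M2' ->
    Rs `&` roles N = fset0 ->
    step D (Case N M1 M2) a Rs (Case N M1' M2')
| S_CaseL D (V : val) M M' :
    step D (Case (Inl V) M M') Tau fset0 (subst0 V M)
| S_CaseR D (V : val) M M' :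
    step D (Case (Inr V) M M') Tau fset0 (subst0 V M')
| S_Proj1 D (V V' : val) :
    step D (App Fst (Pair V V')) Tau fset0 V
| S_Proj2 D (V V' : val) :
    step D (App Snd (Pair V V')) Tau fset0 V'
| S_Def D f Rs Rs' M :
    D f Rs' = Some M ->
    size Rs' = size Rs ->
    step D (Call f Rs) Tau fset0 (rsub_chor Rs' Rs M)
| S_Com D Q R (V : val) :
    closed_chor V ->
    step D (App (Com Q R) V) Tau [fset Q; R] (rsub_val [:: Q] [:: R] V)
| S_Sel D Q R l M :
    step D (Select Q R l M) Tau [fset Q; R] M
| S_InSel D Q R l M M' a Rs :
    step D M a Rs M' ->
    Rs `&` [fset Q; R] = fset0 ->
    step D (Select Q R l M) a Rs (Select Q R l M')
| S_Str D M N M' Rs :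
    clos_refl_trans chor rewr M N ->
    step D N Tau Rs M' ->
    step D M Tau Rs M'.

Definition reduces (D : defs) (M M' : chor) : Prop :=
  exists Rs, step D M Tau Rs M'.

(* Main.v *)
Require Import Defs.
From Stdlib Require Import List Relation_Operators.
From mathcomp Require Import all_boot finmap.

(** Induction on the typing derivation.  The only delicate point is [Ty_Eq],
    which might have given a value a type unrelated to its shape: it applies to
    terms whose type is a type name, and no other rule gives such a type to a
    closed value, so it never applies to one. *)

Local Open Scope fset_scope.

Lemma fsetU_eq0 (K : choiceType) (A B : {fset K}) :
  A `|` B = fset0 -> A = fset0 /\ B = fset0.
Proof.
move=> AB0; split; apply/eqP; rewrite -fsubset0 -AB0.
- exact: fsubsetUl.
- exact: fsubsetUr.
Qed.

Lemma uniq_map_In_inj (A : Type) (B : eqType) (h : A -> B) (s : seq A) x y :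
  uniq (map h s) -> In x s -> In y s -> h x = h y -> x = y.
Proof.
have In_map z r : In z r -> h z \in map h r.
  elim: r => //= w r IHr [-> | /IHr zr]; first exact: mem_head.
  by rewrite inE zr orbT.
elim: s => //= z s IHs /andP[hz us] [<- | xs] [<- | ys] // hxy.
- by case/negP: hz; rewrite hxy; apply: In_map.
- by case/negP: hz; rewrite -hxy; apply: In_map.
- exact: IHs.
Qed.

(** The clauses for [Fst] and [Snd] record a product domain, which later forces their argument to be
    a pair. No value is canonical at a [TName], so in the [Ty_Eq] case of the next lemma the
    induction hypothesis is contradictory. *)
Definition canonical (V : Defs.val) (T : ty) : Prop :=
  match V, T with
  | Lam _ _, TArr _ _ _
  | Com _ _, TArr _ _ _
  | Fst, TArr (TProd _ _) _ _
  | Snd, TArr (TProd _ _) _ _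
  | Inl _, TSum _ _
  | Inr _, TSum _ _
  | Pair _ _, TProd _ _
  | Unit _, TUnit _ => True
  | _, _ => False
  end.

Lemma closed_value_canonical Theta Sigma Gamma (V : Defs.val) T :
  fv_val V = fset0 -> typed Theta Sigma Gamma V T -> canonical V T.
Proof.
move=> fvV; move: {-2}(Val V) (erefl (Val V)) => M defM typM.
elim: typM V defM fvV => {Theta Sigma Gamma M T} //;
  try by move=> *; match goal with H : Val _ = Val _ |- _ => case: H => <- end.
- move=> Theta Sigma Gamma i T _ _ V [<-] /= /fsetP/(_ i).
  by rewrite !inE eqxx.
- move=> Theta Sigma Gamma M t Rs Rs' T _ IH _ _ _ _ V defM fvV.
  by have := IH V defM fvV; case: V {defM fvV}.
Qed.

(** Every left-hand side of [rewr] is an application, so no rewriting starts at a value. *)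
Lemma rewr_value (V : Defs.val) N : clos_refl_trans chor rewr V N -> N = V.
Proof.
move: {-2}(Val V) (erefl (Val V)) => M defM MN.
elim: MN defM => {M N}.
- by move=> M N [] *; discriminate.
- by [].
- by move=> M N P _ IHMN _ IHNP defM; rewrite IHNP ?IHMN.
Qed.

(** An abstraction may step by [S_InAbs], but only with label [Lambda]. The one [Tau] rule whose
    source can be a value is [S_Str], and rewriting leaves the value in place. *)
Lemma value_not_step_tau D (V : Defs.val) Rs M : ~ step D V Tau Rs M.
Proof.
move: {-2}(Val V) (erefl (Val V)) {-2}Tau (erefl Tau) => N defN a defa st.
elim: st V defN defa => // {}D N' P M' Rs' NP _ IH V defN.
by move: NP; rewrite defN => /rewr_value; apply: IH.
Qed.

(** The induction never enters a binder: abstractions are values, and a case either steps in its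
    scrutinee or selects a branch. Hence closedness and the condition on called names pass to the
    subterms considered. *)
Lemma progress Theta Sigma Gamma M T D :
  typed Theta Sigma Gamma M T -> fv M = fset0 -> wf_tctx Gamma ->
  (forall f, f \in called M -> exists Rs N, D f Rs = Some N) ->
  (forall f Rs N, D f Rs = Some N ->
     exists U, In (FDecl f Rs U) (funs Gamma)) ->
  is_value M \/ exists M', reduces D M M'.
Proof.
elim=> {Theta Sigma Gamma M T} /=;
  try by move=> *; left; eexists.
- move=> Theta Sigma Gamma N M T rho T' typN IHN typM IHM.
  move=> /fsetU_eq0[fvN fvM] wfG defNM defG.
  have defN f : f \in called N -> exists Rs P, D f Rs = Some P.
    by move=> fN; apply: defNM; rewrite inE fN.
  have defM f : f \in called M -> exists Rs P, D f Rs = Some P.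
    by move=> fM; apply: defNM; rewrite inE fM orbT.
  right; case: (IHN fvN wfG defN defG) => [[V eqV] | [N' [Rs NN']]]; last first.
    (* [N] steps with label [Tau], so the side condition of [S_App1] on [Lambda] is vacuous. *)
    by exists (App N' M), Rs; apply: S_App1 NN' _.
  subst N; case: (IHM fvM wfG defM defG) => [[W eqW] | [M' [Rs MM']]]; last first.
    by exists (App V M'), Rs; apply: S_App2.
  subst M; have := closed_value_canonical _ _ _ _ _ fvN typN.
  have := closed_value_canonical _ _ _ _ _ fvM typM.
  (* Only [Lam], [Fst], [Snd] and [Com] are canonical at an arrow type. *)
  case: V {typN IHN fvN defN defNM} => //=.
  + by move=> U P _ _; eexists _, _; apply: S_AppAbs.
  + by case: T {typM IHM} => // T1 T2; case: W {fvM defM} => // V1 V2 _ _;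
      eexists _, _; apply: S_Proj1.
  + by case: T {typM IHM} => // T1 T2; case: W {fvM defM} => // V1 V2 _ _;
      eexists _, _; apply: S_Proj2.
  (* The message must be closed, which is [fvM]. *)
  + by move=> Q R _ _; eexists _, _; apply: S_Com.
- move=> Theta Sigma Gamma N M1 M2 T1 T2 T typN IHN _ _ _ _.
  move=> /fsetU_eq0[/fsetU_eq0[fvN _] _] wfG defNM defG.
  have defN f : f \in called N -> exists Rs P, D f Rs = Some P.
    by move=> fN; apply: defNM; rewrite !inE fN.
  right; case: (IHN fvN wfG defN defG) => [[V eqV] | [N' [Rs NN']]]; last first.
    by exists (Case N' M1 M2), Rs; apply: S_Case.
  subst N; have := closed_value_canonical _ _ _ _ _ fvN typN.
  case: V {typN IHN fvN defN defNM} => // V _; eexists _, _.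
  + exact: S_CaseL.
  + exact: S_CaseR.
- move=> Theta Sigma Gamma Q R l M *.
  by right; exists M, [fset Q; R]; apply: S_Sel.
- move=> Theta Sigma Gamma f Rs' Rs T fG _ _ szRs _ _ wfG defM defG.
  have [Ps [N DfN]] := defM f (fset11 _).
  have [U fPsG] := defG _ _ _ DfN.
  (* [D] might define [f] with parameters other than the declared [Rs']. Names are unique in
     [Gamma], so [Ps] is [Rs'], and the arity condition of [S_Def] follows from the typing rule. *)
  have [eqPs _] := uniq_map_In_inj _ _ _ _ _ _ wfG fPsG fG erefl.
  right; exists (rsub_chor Ps Rs N), fset0; apply: S_Def => //.
  by rewrite eqPs.
(* [Ty_Eq] changes only the type, so the induction hypothesis is the goal. *)
- by [].
Qed.

Theorem theorem14 (M : chor) (D : defs) :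
  closed_chor M ->
  has_necessary_defs D M ->
  (exists (Theta : {fset role}) (Sigma : seq tdef) (Gamma : tctx) (T : ty),
      [/\ wf_tdefs Sigma, wf_tctx Gamma,
          typed Theta Sigma Gamma M T & typed_defs Theta Sigma Gamma D]) ->
  (is_value M /\ ~ (exists M' : chor, reduces D M M')) \/
  (exists M' : chor, reduces D M M').
Proof.
move=> clM needM [Theta [Sigma [Gamma [T [_ wfG typM typD]]]]].
have defM f : f \in called M -> exists Rs N, D f Rs = Some N.
  by move=> fM; apply: needM; apply: Needed_here.
have defG f Rs N : D f Rs = Some N -> exists U, In (FDecl f Rs U) (funs Gamma).
  by move=> /typD[U [fG _ _ _]]; exists U.
case: (progress _ _ _ _ _ _ typM clM wfG defM defG) => [[V ->] | ]; last by right.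
left; split; first by exists V.
by case=> M' [Rs /value_not_step_tau].
Qed.
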